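(* There exists a function $g:[1,\infty)\to\mathbb{R}$ with $g(x)=0$ for $1\le x\le20$ and \[ g(x)=x\log x-x\log\log\log x+O(x)\qquad(x>20), \] such that for all integers $1\le m\le n$, \[ \mathbb{P}\big(C_{[m]}(\sigma)=0\big)=e^{-H_m}\left(1+O\big(e^{-g(n/m)}\big)\right). \]
   Context: The probability $\mathbb{P}$ is with respect to a uniformly random permutation $\sigma$ in the symmetric group $\mathcal{S}_n$ on $\{1,\ldots,n\}$. $C_{[m]}(\sigma)$ is the number of cycles of $\sigma$ of length at most $m$ (fixed points count as cycles of length 1). $H_m=\sum_{i=1}^m1/i$. The notation $f=O(h)$ means that there is a constant $C>0$ with $|f|\le Ch$ throughout the stated domain; both implied constants here are absolute (independent of $x$, $n$, $m$). *)

(* Defs.v *)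
From mathcomp Require Import all_boot all_order all_algebra all_fingroup.
From mathcomp Require Import all_classical all_reals all_analysis.

Set Implicit Arguments.
Unset Strict Implicit.
Unset Printing Implicit Defensive.

Import Order.TTheory GRing.Theory Num.Theory.
Local Open Scope ring_scope.

(* The ground set {1, ..., n} of the symmetric group is relabelled as 'I_n.
   [porbits s] contains the singleton orbits, so fixed points are counted. *)
Definition num_short_cycles (n m : nat) (s : 'S_n) : nat :=
  #|[set c : {set 'I_n} in porbits s | (#|c| <= m)%N]|.

Definition perm_prob (R : realType) (n : nat) (A : {set 'S_n}) : R :=
  #|A|%:R / #|[set: 'S_n]|%:R.

Definition harmonic_number (R : realType) (m : nat) : R :=
  \sum_(1 <= i < m.+1) i%:R^-1.

(* Main.v *)
Require Import Defs.
From mathcomp Require Import all_boot all_order all_algebra all_fingroup.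
From mathcomp Require Import all_classical all_reals all_analysis.
From mathcomp Require Import zify ring lra.

Set Implicit Arguments.
Unset Strict Implicit.
Unset Printing Implicit Defensive.

Import Order.TTheory GRing.Theory Num.Theory.
Local Open Scope ring_scope.

(** Call a permutation [m]-rough when all its cycles are longer than [m], and
    let [p n] be the probability that a permutation of [n] points is rough.
    Splitting off the cycle through a given point, whose length is uniform on
    [1 .. n], gives [n p_n = p_0 + ... + p_(n-m-1)] ([rough_prob_rec]).  Two
    consequences follow.

    First, [p n <= 1 / (m + 1)] for [n >= 1] by induction
    ([rough_prob_le]), while [e^(H_m) <= e m]; hence [e^(H_m) p_n] is
    bounded, which is all that is asked for [n / m <= 20].

    Secondly, the increments [a_n = p_n - p_(n-1)] satisfy
    [n a_n = - (a_(n-1) + ... + a_(n-m))]: each block of [m] indices further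
    out costs a factor [m / n].  Iterating over about [n / m] blocks makes
    [a_n] factorially small, [|a_n| <= 1 / (m^2 k!)] as soon as
    [n >= (k + 3) m] ([rough_step_le]).  The initial [1 / m^2] comes from
    [p_n = O(1 / m)], and it makes the estimate uniform in [m].

    To compare [p_n] with [e^(- H_m)], let [f] be the generating polynomial of
    the increments up to [a_N] and [h = X + X^2/2 + ... + X^m/m], so that
    [f(1) = p_N] and [h(1) = H_m].  The recurrence for the increments says that
    the coefficients of [f' + h' f] vanish below degree [N]; the others are sums
    of at most [m] small increments.  So [f e^h] has a small derivative on
    [[0, 1]], and its values [1] at [0] and [p_N e^(H_m)] at [1] are close
    ([rough_prob_approx]).  The result is
    [|p_n e^(H_m) - 1| <= e / k!] for [n >= (k + 4) m]
    ([rough_prob_relative_error]).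

    With [k] equal to [n / m] up to a bounded shift, [k!] is at least
    [e^(x log x - 7 x)] at [x = n / m].  For [x > 20] the iterated logarithm
    [log log log x] is at least [-1], so the term [- x log log log x] in [g]
    can only weaken the requirement up to [O(x)]. *)

(** * Counting permutations without short cycles *)

Section RoughPermutations.
Import mathcomp.boot.fintype mathcomp.boot.finset.
Local Open Scope nat_scope.
Variable T : finType.
Implicit Types (A B C : {set T}) (s t : {perm T}) (x y : T) (m : nat).

Definition rough_perms m A : {set {perm T}} :=
  [set s | perm_on A s && [forall x in A, m < #|porbit s x|]].

Definition full_cycles C x : {set {perm T}} :=
  [set s | perm_on C s && (porbit s x == C)].

Lemma eq_porbit_on B s t x : {in B, forall y, s y \in B} ->
  {in B, s =1 t} -> x \in B -> porbit s x = porbit t x.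
Proof.
move=> sB eq_st xB.
have it i : (s ^+ i)%g x = (t ^+ i)%g x /\ (s ^+ i)%g x \in B.
  elim: i => [|i [IH1 IH2]]; first by rewrite !expg0 perm1.
  by rewrite !expgSr !permM -IH1 eq_st // -eq_st ?sB.
apply/setP=> y; apply/porbitP/porbitP => -[i ->]; exists i.
  by have [] := it i.
by have [->] := it i.
Qed.

Lemma perm_on_porbit_sub A s x : perm_on A s -> x \in A -> porbit s x \subset A.
Proof.
move=> sA xA; apply/subsetP=> y /porbitP[i ->].
by elim: i => [|i IH]; rewrite ?expg0 ?perm1 // expgSr permM perm_closed.
Qed.

(** Once the cycle [C] of [x] is prescribed, a rough permutation of [A] is a
    product of a full cycle on [C] and a rough permutation of the rest. *)
Lemma rough_perms_orbit m A C x : C \subset A -> x \in C -> m < #|C| ->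
  #|[set s in rough_perms m A | porbit s x == C]| =
    #|full_cycles C x| * #|rough_perms m (A :\: C)|.
Proof.
move=> sCA xC mC; rewrite -cardsX.
(* The bijection is multiplication of permutations with disjoint supports. *)
pose mul (u : {perm T} * {perm T}) := (u.1 * u.2)%g.
have prodE s1 s2 : perm_on C s1 -> perm_on (A :\: C) s2 ->
    {in C, (s1 * s2)%g =1 s1} /\ {in ~: C, (s1 * s2)%g =1 s2}.
  move=> h1 h2; split=> y yC; rewrite permM.
    by rewrite (out_perm h2) // inE perm_closed // yC.
  by rewrite (out_perm h1) //; move: yC; rewrite inE.
have out1 s2 : perm_on (A :\: C) s2 -> {in ~: C, forall y, s2 y \in ~: C}.
  move=> h2 y; rewrite inE => yC.
  have [yA|yA] := boolP (y \in A); last by rewrite (out_perm h2) ?inE ?(negPf yA) ?andbF.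
  have : s2 y \in A :\: C by rewrite perm_closed // inE yC.
  by rewrite !inE => /andP[].
rewrite -(card_in_imset (f := mul)); last first.
  move=> [s1 s2] [t1 t2]; rewrite !inE /= /mul /=.
  move=> /andP[/andP[h1 _] /andP[h2 _]] /andP[/andP[k1 _] /andP[k2 _]] eq_st.
  have [e1 e2] := prodE _ _ h1 h2; have [f1 f2] := prodE _ _ k1 k2.
  have E1 : s1 = t1.
    apply/permP=> y; have [yC|yC] := boolP (y \in C).
      by rewrite -e1 // eq_st f1.
    by rewrite (out_perm h1) // (out_perm k1).
  by congr pair => //; apply: (@mulgI _ s1); rewrite eq_st E1.
apply: eq_card => s; apply/idP/imsetP => [|[[s1 s2]]]; last first.
  rewrite !inE /= /mul /= => /andP[/andP[h1 /eqP o1]] /andP[h2 /forall_inP o2] ->{s}.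
  have [e1 e2] := prodE _ _ h1 h2.
  have orb1 y : y \in C -> porbit (s1 * s2)%g y = porbit s1 y.
    move=> yC; apply/esym; apply: (@eq_porbit_on C) => // z zC.
      by rewrite perm_closed.
    by rewrite e1.
  have orb2 y : y \in ~: C -> porbit (s1 * s2)%g y = porbit s2 y.
    move=> yC; apply/esym; apply: (@eq_porbit_on (~: C)) => //; first exact: out1.
    by move=> z zC; rewrite e2.
  rewrite orb1 // o1 eqxx andbT; apply/andP; split.
    apply: perm_onM; apply/subsetP=> y.
      by move/(subsetP h1)/(subsetP sCA).
    by move/(subsetP h2); rewrite inE => /andP[].
  apply/forall_inP=> y yA; have [yC|yC] := boolP (y \in C).
    rewrite orb1 //; have : y \in porbit s1 x by rewrite o1.
    by rewrite -eq_porbit_mem => /eqP ->; rewrite o1.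
  by rewrite orb2 ?inE // o2 // inE yC.
rewrite !inE => /andP[/andP[hA /forall_inP hm] /eqP oC].
have sC y : y \in C -> s y \in C.
  move=> yC; have : y \in porbit s x by rewrite oC.
  rewrite -eq_porbit_mem -oC => /eqP <-.
  by have := mem_porbit s 1 y; rewrite expg1.
have sN : s \in ('N(C | 'P))%g.
  by rewrite !inE /=; apply/subsetP=> y yC; rewrite !inE /= /aperm; exact: sC.
(* The factors of [s] are its restriction [r] to [C] and [r^-1 * s]. *)
pose r := restr_perm C s.
have rC : perm_on C r by exact: restr_perm_on.
have rE : {in C, r =1 s} by move=> y yC; rewrite /r restr_permE.
have r'C : perm_on C r^-1%g by exact: perm_onV.
have qE y : y \notin C -> (r^-1 * s)%g y = s y.
  by move=> yC; rewrite permM (out_perm r'C).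
have qA : perm_on (A :\: C) (r^-1 * s)%g.
  apply/subsetP=> y; rewrite !inE; have [yC|yC] := boolP (y \in C).
    by rewrite permM -rE ?perm_closed // permKV eqxx.
  by rewrite qE //= => /(subsetP hA).
exists (r, (r^-1 * s)%g); last by rewrite /mul /= mulKVg.
rewrite !inE /= rC qA /=; apply/andP; split.
  by rewrite (@eq_porbit_on C _ s) ?oC // => y yC; rewrite perm_closed.
apply/forall_inP=> y; rewrite inE => /andP[yC yA].
rewrite (@eq_porbit_on (~: C) _ s) ?hm //; last by rewrite inE.
- exact: out1.
- by move=> z; rewrite inE; exact: qE.
Qed.

Lemma card_rough_perms_rec m A x : x \in A ->
  #|rough_perms m A| =
  \sum_(C : {set T} | [&& C \subset A, x \in C & m < #|C|])
     #|full_cycles C x| * #|rough_perms m (A :\: C)|.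
Proof.
move=> xA.
rewrite -sum1_card (partition_big (fun s : {perm T} => porbit s x)
  (fun C : {set T} => [&& C \subset A, x \in C & m < #|C|])) /=; last first.
  move=> s; rewrite inE => /andP[h /forall_inP o].
  by rewrite perm_on_porbit_sub // porbit_id o.
apply: eq_bigr => C /and3P[h1 h2 h3].
rewrite -(rough_perms_orbit h1) // -sum1_card; apply: eq_bigl => s.
by rewrite !inE.
Qed.

Lemma sum_subsets_by_card (F : nat -> nat) A x : x \in A ->
  \sum_(C : {set T} | (C \subset A) && (x \in C)) F #|C| =
  \sum_(k < #|A|) 'C(#|A|.-1, k) * F k.+1.
Proof.
move=> xA.
have cA : #|A| = #|A :\ x|.+1 by rewrite (cardsD1 x A) xA.
rewrite (partition_big (fun C : {set T} => inord #|C|.-1 : 'I_(#|A|.-1.+1)) predT) //=.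
have -> : #|A| = #|A|.-1.+1 by rewrite cA.
rewrite -pred_Sn; apply: eq_bigr => k _.
have mem C : (C \subset A) && (x \in C) ->
    [/\ #|C :\ x|.+1 = #|C| & #|C :\ x| < #|A|.-1.+1].
  move=> /andP[CA xC]; rewrite (cardsD1 x C) xC; split=> //.
  by rewrite ltnS cA /=; apply/subset_leq_card/setSD.
rewrite (eq_bigr (fun=> F k.+1)); last first.
  move=> C /andP[/mem[e l] /eqP <-]; rewrite -e /= inordK //.
rewrite sum_nat_const; congr (_ * _).
transitivity 'C(#|A :\ x|, k); last by congr binomial; rewrite cA.
rewrite -cards_draws -[RHS](card_in_imset (f := fun B => x |: B)).
  apply: eq_card => C; apply/idP/imsetP.
    rewrite !unfold_in => /andP[h /eqP hk]; have [e l] := mem _ h.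
    exists (C :\ x); last by rewrite setD1K //; case/andP: h.
    rewrite inE setSD; last by case/andP: h.
    by rewrite -hk -e /= inordK.
  move=> [B]; rewrite inE => /andP[BA /eqP cB] ->.
  have xB : x \notin B by apply/negP => /(subsetP BA); rewrite !inE eqxx.
  rewrite unfold_in setU11 andbT subUset sub1set xA /= (subset_trans BA) ?subD1set //=.
  by rewrite cardsU1 xB cB add1n /= inord_val.
move=> B B'; rewrite !inE => /andP[BA _] /andP[BA' _] e.
have nx (D : {set T}) : D \subset A :\ x -> (x |: D) :\ x = D.
  move=> DA; apply: setU1K; apply/negP => /(subsetP DA); by rewrite !inE eqxx.
by rewrite -(nx B) // e nx.
Qed.

Lemma card_rough_perms0 A : #|rough_perms 0 A| = (#|A|)`!.
Proof.
rewrite -card_perm; apply: eq_card => s; rewrite !inE andb_idr // => _.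
apply/forall_inP => x _.
by apply/card_gt0P; exists x; rewrite porbit_id.
Qed.

Lemma binpred_fact n k : k < n -> 'C(n.-1, k) * (k`! * (n - k.+1)`!) = n.-1`!.
Proof. by case: n => // n; rewrite ltnS => kn; rewrite subSS bin_fact. Qed.

(** Without any constraint on cycle lengths the decomposition by the cycle of
    [x] counts all [n!] permutations.  The term of size [k] contributes
    [(n-1)!] for every [k < n] by induction, so the remaining term [k = n]
    must equal [(n-1)!] too. *)
Lemma card_full_cycles C x : x \in C -> #|full_cycles C x| = #|C|.-1`!.
Proof.
have [n] := ubnP #|C|; elim: n C => // n IH C /ltnSE leCn xC.
have := card_rough_perms_rec 0 xC; rewrite card_rough_perms0.
(* [c] replaces the counts known by induction by their values, which leaves the
   term [D = C] as the only unknown. *)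
pose c k := if k == #|C| then #|full_cycles C x| else k.-1`!.
rewrite (eq_big (fun D : {set T} => (D \subset C) && (x \in D))
   (fun D : {set T} => c #|D| * (#|C| - #|D|)`!)); first last.
- move=> D /and3P[DC xD _]; rewrite card_rough_perms0 cardsD (setIidPr DC).
  rewrite /c; case: eqP => [e|/eqP ne].
    by have -> : D = C by apply/eqP; rewrite eqEcard DC e /=.
  by rewrite IH // (leq_trans _ leCn) // ltn_neqAle ne subset_leq_card.
- move=> D; rewrite card_gt0; case: (_ \subset _) => //=.
  by case xD : (x \in D) => //=; apply/set0Pn; exists x.
rewrite (sum_subsets_by_card (fun k => c k * (#|C| - k)`!)) //.
have cC : 0 < #|C| by apply/card_gt0P; exists x.
case def_n: #|C| cC => [//|k] _; rewrite big_ord_recr /= binn subnn fact0 muln1 mul1n.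
rewrite (eq_bigr (fun=> k`!)); last first.
  move=> i _; rewrite /c def_n eqSS ltn_eqF //= -(@binpred_fact k.+1 i) //.
  exact: leq_trans (ltn_ord i) _.
rewrite sum_nat_const card_ord /c def_n eqxx factS mulSn addnC.
by move/addnI => ->.
Qed.

(** The right-hand side depends on [A] through its cardinal only, which is what
    lets an induction transfer counts between different ground sets. *)
Lemma card_rough_perms_recurrence m A (w : nat -> nat) : 0 < #|A| ->
  (forall B, #|B| < #|A| -> #|rough_perms m B| = w #|B|) ->
  #|rough_perms m A| =
  \sum_(k < #|A| | m <= k) 'C(#|A|.-1, k) * (k`! * w (#|A| - k.+1)).
Proof.
move=> /card_gt0P[x xA] hw.
rewrite (card_rough_perms_rec m xA).
pose F k := if m < k then k.-1`! * w (#|A| - k) else 0.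
transitivity (\sum_(C : {set T} | (C \subset A) && (x \in C)) F #|C|).
  rewrite [RHS](bigID (fun C : {set T} => m < #|C|)) /= [X in _ = _ + X]big1 ?addn0.
    apply: eq_big => [C|C /and3P[CA xC mC]]; first by rewrite andbA.
    rewrite /F mC card_full_cycles // hw cardsD (setIidPr CA) //.
    by rewrite ltn_subrL; apply/andP; split; apply/card_gt0P; exists x.
  by move=> C /andP[_ /negPf mC]; rewrite /F mC.
rewrite sum_subsets_by_card // [RHS]big_mkcond /=; apply: eq_bigr => k _.
by rewrite /F ltnS; case: ifP; rewrite ?muln0.
Qed.

End RoughPermutations.

(** * The recurrence for the probability *)

Section RoughProbability.
Local Open Scope nat_scope.

Lemma card_rough_perms_ord m (T : finType) (A : {set T}) :
  #|rough_perms m A| = #|rough_perms m [set: 'I_(#|A|)]|.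
Proof.
have [n] := ubnP #|A|; elim: n T A => // n IH T A /ltnSE leAn.
have [A0|A0] := posnP #|A|.
  have noorb (U : finType) (B : {set U}) : #|B| = 0 -> #|rough_perms m B| = 1.
    move=> B0; have -> : rough_perms m B = rough_perms 0 B.
      apply/boot.finset.setP=> s; rewrite !inE; congr andb.
      by apply/idP/idP => _; apply/forall_inP => y; rewrite (card0_eq B0).
    by rewrite card_rough_perms0 B0.
  by rewrite !noorb // A0 cardsT card_ord.
have cI : #|[set: 'I_(#|A|)]| = #|A| by rewrite cardsT card_ord.
rewrite (@card_rough_perms_recurrence _ m A (fun k => #|rough_perms m [set: 'I_k]|)) //.
  rewrite (@card_rough_perms_recurrence _ m [set: 'I_(#|A|)]
    (fun k => #|rough_perms m [set: 'I_k]|)) ?cI //.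
  by move=> B BA; apply: IH; exact: leq_trans BA leAn.
by move=> B BA; apply: IH; exact: leq_trans BA leAn.
Qed.

Local Open Scope ring_scope.
Variable R : realType.

Definition rough_prob m n : R := #|rough_perms m [set: 'I_n]|%:R / n`!%:R.

Lemma rough_prob0 m : rough_prob m 0 = 1.
Proof.
rewrite /rough_prob (_ : #|_| = 1%N) ?fact0 ?divr1 //.
rewrite -[RHS](cards1 (1%g : 'S_0)); apply: eq_card => s.
rewrite !inE [s]permS0 eqxx perm_on1 /=.
by apply/forall_inP => -[].
Qed.

(** The length of the cycle through a given point is uniform on [1 .. n.+1], and
    the rest of the permutation is then uniform. *)
Lemma rough_prob_rec m n :
  n.+1%:R * rough_prob m n.+1 = \sum_(j < n.+1 - m) rough_prob m j.
Proof.
have cI k : #|[set: 'I_k]| = k by rewrite cardsT card_ord.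
have := @card_rough_perms_recurrence _ m [set: 'I_n.+1]
  (fun k => #|rough_perms m [set: 'I_k]|).
rewrite cI => /(_ isT) H.
rewrite /rough_prob H; last by move=> B _; exact: card_rough_perms_ord.
have fact_neq0 k : k`!%:R != 0 :> R by rewrite pnatr_eq0 -lt0n fact_gt0.
rewrite factS natrM invfM mulrCA mulVKf ?pnatr_eq0 //.
rewrite (big_ord_widen n.+1 (fun j => rough_prob m j) (leq_subr m n.+1)).
rewrite natr_sum mulr_suml [RHS](reindex_inj rev_ord_inj) /=.
apply: eq_big => [k|k _]; first by rewrite subSS; have := ltn_ord k; lia.
rewrite subSS -(bin_fact (ltn_ord k : (k <= n)%N)) !natrM.
rewrite /rough_prob; field.
by rewrite !fact_neq0 pnatr_eq0 -lt0n bin_gt0 -ltnS ltn_ord.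
Qed.

Lemma perm_prob_rough m n :
  perm_prob R [set s : 'S_n | num_short_cycles m s == 0%N] = rough_prob m n.
Proof.
rewrite /perm_prob /rough_prob cardsT card_Sn; congr (_%:R / _).
apply: eq_card => s; rewrite !inE /num_short_cycles cards_eq0.
have -> : perm_on [set: 'I_n] s by apply/fintype.subsetP => x _; rewrite inE.
apply/eqP/forall_inP => [e x _|h].
  rewrite ltnNge; apply/negP => le_xm.
  have : porbit s x \in [set c in porbits s | (#|c| <= m)%N].
    by rewrite inE le_xm andbT; apply: imset_f.
  by rewrite e inE.
apply/boot.finset.setP => c; rewrite !inE; apply/negP => /andP[/imsetP[x _ ->]].
by rewrite leqNgt h ?inE.
Qed.

End RoughProbability.

(** * Increments of functions and exponentials of harmonic numbers *)

(** Comparing [f] with [c t^(N+1) / (N+1)] instead of using a uniform bound on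
    the derivative keeps the factor [1 / (N+1)].  That factor will absorb the
    [m] lost in [e^(H_m) <= e m]. *)
Lemma dominated_increment (R : realType) (f df : R -> R) (c : R) N :
  (forall t : R, is_derive t 1 f (df t)) ->
  (forall t, 0 <= t <= 1 -> `|df t| <= c * t ^+ N) ->
  `|f 1 - f 0| <= c / N.+1%:R.
Proof.
move=> fd dom.
have key (g dg : R -> R) : (forall t : R, is_derive t 1 g (dg t)) ->
    (forall t, 0 <= t <= 1 -> `|dg t| <= c * t ^+ N) ->
    g 1 - g 0 <= c / N.+1%:R.
  move=> gd gdom.
  pose q := (c / N.+1%:R) *: 'X^(N.+1) : {poly R}.
  pose K : R -> R := horner q - g.
  have Kd (t : R) : is_derive t 1 K (c * t ^+ N - dg t).
    have gt := gd t; have qt := is_derive_poly q t.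
    apply: (is_derive_eq (is_deriveB qt gt)).
    rewrite /q derivZ derivXn hornerZ hornerMn hornerXn /=; congr (_ - _).
    by rewrite -[t ^+ N *+ _]mulr_natl mulrA mulfVK // pnatr_eq0.
  have KE t : K t = c / N.+1%:R * t ^+ N.+1 - g t.
    by rewrite /K /= !fctE hornerZ hornerXn.
  have : K 0 <= K 1.
    apply: (@ger0_derive1_ndecr _ K 0 1); rewrite ?lexx ?ler01 //.
    - move=> t; rewrite in_itv /= => /andP[t0 t1].
      have [_ Kv] := Kd t; rewrite derive1E Kv subr_ge0.
      by apply: (le_trans (ler_norm _)); apply: gdom; rewrite !ltW.
    - by apply: derivable_within_continuous => t _; have [] := Kd t.
  rewrite !KE expr1n mulr1 exprS mul0r mulr0 sub0r.
  by move: (c / _) => c'; lra.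
rewrite ler_norml; apply/andP; split; last exact: key fd dom.
have nfd (t : R) : is_derive t 1 (- f) (- df t).
  by have ft := fd t; exact: is_deriveN.
have ndom (t : R) : 0 <= t <= 1 -> `|- df t| <= c * t ^+ N.
  by move=> t01; rewrite normrN; exact: dom.
have := key _ _ nfd ndom; rewrite !fctE.
by move: (c / _) => c'; lra.
Qed.

Lemma expR_harmonic_le (R : realType) n :
  expR (harmonic_number R n.+1) <= expR 1 * n.+1%:R.
Proof.
elim: n => [|n IH]; first by rewrite /harmonic_number big_nat1 invr1 mulr1.
rewrite /harmonic_number big_nat_recr //= expRD.
apply: (le_trans (ler_wpM2r (expR_ge0 _) IH)); rewrite -mulrA.
apply: ler_wpM2l; first exact: expR_ge0.
(* It remains to see that [e^y <= (n+2) / (n+1)] for [y = 1 / (n+2)], which is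
   [1 - y <= e^(-y)]. *)
have := expR_ge1Dx (- n.+2%:R^-1 : R); rewrite expRN => H.
rewrite -(ler_pM2r (_ : 0 < (expR n.+2%:R^-1)^-1)) ?invr_gt0 ?expR_gt0 //.
rewrite mulfK ?gt_eqF ?expR_gt0 //.
apply: le_trans (ler_wpM2l (ler0n _ n.+2) H).
by rewrite mulrDr mulrN divff ?pnatr_eq0 // mulr1 -[n.+2%:R]natr1 addrK.
Qed.

(** * Decay of the increments *)

Section RoughAnalysis.
Variables (R : realType) (m : nat).
Local Notation p := (rough_prob R m).

(** The bound reproduces itself: the recurrence gives at most
    [1 + (n - m) / (m + 1) = (n + 1) / (m + 1)], where the [1] is [p 0]. *)
Lemma rough_prob_le n : 0 <= p n.+1 <= m.+1%:R^-1.
Proof.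
have [k] := ubnP n; elim: k n => // k IH n /ltnSE le_nk.
have := rough_prob_rec R m n; have [lt_nm|le_mn] := ltnP n m.
  have /eqP -> : (n.+1 - m == 0)%N by rewrite subn_eq0.
  rewrite big_ord0 => /eqP; rewrite mulf_eq0 pnatr_eq0 /= => /eqP ->.
  by rewrite lexx invr_ge0 ler0n.
rewrite subSn // big_ord_recl rough_prob0 => E.
have bnd (j : 'I_(n - m)) : 0 <= p (lift ord0 j) <= m.+1%:R^-1.
  by rewrite lift0; apply: IH; apply: leq_trans le_nk; have := ltn_ord j; lia.
have S0 : 0 <= \sum_(j < n - m) p (lift ord0 j).
  by apply: sumr_ge0 => j _; case/andP: (bnd j).
have S1 : \sum_(j < n - m) p (lift ord0 j) <= (n - m)%:R * m.+1%:R^-1.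
  rewrite -[X in X%:R * _]card_ord mulr_natl -sumr_const; apply: ler_sum => j _.
  by case/andP: (bnd j).
apply/andP; split.
  by rewrite -(pmulr_rge0 _ (_ : 0 < n.+1%:R)) ?ltr0n // E; lra.
rewrite -(ler_pM2l (_ : 0 < n.+1%:R)) ?ltr0n // E.
apply: (le_trans (lerD (lexx 1) S1)).
rewrite -[X in X + _](@divff _ m.+1%:R) ?pnatr_eq0 // -mulrDl -natrD.
by rewrite ler_pM2r ?invr_gt0 ?ltr0n // ler_nat; lia.
Qed.

Hypothesis m_gt0 : (0 < m)%N.

(** These are the Taylor coefficients of [exp (- (z + z^2/2 + ... + z^m/m))]. *)
Definition rough_step n : R := if n is n'.+1 then p n - p n' else p 0.
Local Notation a := rough_step.

Lemma sum_rough_step n : \sum_(i < n.+1) a i = p n.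
Proof.
elim: n => [|n IH]; first by rewrite big_ord1.
by rewrite big_ord_recr /= IH addrC subrK.
Qed.

Lemma window_rough_step l n :
  \sum_(j < l) (if (n < j)%N then 0 else a (n - j)) =
  p n - (if (l <= n)%N then p (n - l) else 0).
Proof.
elim: l => [|l IH]; first by rewrite big_ord0 subn0 subrr.
rewrite big_ord_recr /= IH.
case: (ltngtP n l) => [lt|lt|->]; rewrite ?addr0 //.
  rewrite -[in a _](subnSK lt) /=; rewrite -[in p (n - l)](subnSK lt); ring.
by rewrite subnn /=; ring.
Qed.

(** The differential equation [f' = - (1 + z + ... + z^(m-1)) f] of the
    generating function, read off coefficientwise. *)
Lemma rough_step_rec n : n.+1%:R * a n.+1 =
  - \sum_(j < m) (if (n < j)%N then 0 else a (n - j)).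
Proof.
rewrite window_rough_step /= mulrBr rough_prob_rec.
have E : n%:R * p n = \sum_(j < n - m) p j.
  by case: n => [|n]; [rewrite mul0r big_ord0 | exact: rough_prob_rec].
rewrite -natr1 mulrDl E mul1r; case: leqP => [le|lt].
  by rewrite subSn // big_ord_recr /=; ring.
have /eqP -> : (n.+1 - m == 0)%N by rewrite subn_eq0.
have /eqP -> : (n - m == 0)%N by rewrite subn_eq0 ltnW.
by rewrite big_ord0; ring.
Qed.

(** Each further block of [m] indices gains a factor [m / n <= 1 / (k + 4)] from
    the recurrence.  At the start, [n a_n] is a difference of two probabilities
    that are both at most [1 / (m + 1)]. *)
Lemma rough_step_le k n : ((k + 3) * m <= n)%N ->
  `|a n| <= ((m ^ 2 * k`!)%N%:R)^-1.
Proof.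
elim: k n => [|k IH] [|n] len; try by (move: len; nia).
  have nm : (m <= n)%N by nia.
  have := rough_step_rec n; rewrite window_rough_step nm /= => E.
  have n1 : (0 < n - m)%N by nia.
  have := rough_prob_le (n - m).-1; have := rough_prob_le n.-1.
  rewrite !prednK //; last by lia.
  move=> /andP[h1 h2] /andP[h3 h4].
  have H : n.+1%:R * `|a n.+1| <= m.+1%:R^-1.
    rewrite -[X in X * _]normr_nat -normrM E normrN.
    clear E; move: h1 h2 h3 h4; set c := _^-1; move=> h1 h2 h3 h4.
    by rewrite ler_norml; apply/andP; split; lra.
  rewrite fact0 muln1.
  rewrite -(ler_pM2l (_ : 0 < n.+1%:R)) ?ltr0n //; apply: (le_trans H).
  rewrite ler_pdivlMr ?ltr0n ?expn_gt0 ?m_gt0 //.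
  rewrite ler_pdivrMl ?ltr0n // -natrM ler_nat; nia.
have := rough_step_rec n => E.
have H : n.+1%:R * `|a n.+1| <= m%:R * (m ^ 2 * k`!)%:R^-1.
  rewrite -[X in X * _]normr_nat -normrM E normrN.
  apply: (le_trans (ler_norm_sum _ _ _)).
  rewrite -[m in m%:R]card_ord mulr_natl -sumr_const; apply: ler_sum => j _.
  case: ifP => nj; first by rewrite normr0 invr_ge0 ler0n.
  by apply: IH; have := ltn_ord j; nia.
rewrite -(ler_pM2l (_ : 0 < n.+1%:R)) ?ltr0n //; apply: (le_trans H).
have F0 : (0 < m ^ 2 * k`!)%N by rewrite muln_gt0 expn_gt0 m_gt0 fact_gt0.
rewrite factS mulnCA [in leRHS]natrM invfM mulrA.
apply: ler_wpM2r; first by rewrite invr_ge0 ler0n.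
by rewrite ler_pdivlMr ?ltr0n // -natrM ler_nat; nia.
Qed.

(** * Comparison with the exponential of the harmonic number *)

Definition step_poly N : {poly R} := \poly_(i < N.+1) a i.
Definition harmonic_poly : {poly R} := \sum_(j < m) j.+1%:R^-1 *: 'X^(j.+1).
Local Notation f := step_poly.
Local Notation h := harmonic_poly.

Lemma deriv_harmonic_poly : h^`() = \sum_(j < m) 'X^j.
Proof.
rewrite raddf_sum /=; apply: eq_bigr => j _.
rewrite derivZ derivXn /= -[X in _ *: X]scaler_nat scalerA.
by rewrite mulVf ?scale1r ?pnatr_eq0.
Qed.

Lemma horner_harmonic_poly t : h.[t] = \sum_(j < m) j.+1%:R^-1 * t ^+ j.+1.
Proof. by rewrite horner_sum; apply: eq_bigr => j _; rewrite hornerZ hornerXn. Qed.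

Lemma harmonic_poly1 : h.[1] = harmonic_number R m.
Proof.
rewrite horner_harmonic_poly /harmonic_number big_add1 big_mkord /=.
by apply: eq_bigr => j _; rewrite expr1n mulr1.
Qed.

Lemma harmonic_poly_le t : 0 <= t <= 1 -> h.[t] <= harmonic_number R m.
Proof.
move=> /andP[t0 t1]; rewrite -harmonic_poly1 !horner_harmonic_poly.
apply: ler_sum => j _; rewrite ler_wpM2l ?invr_ge0 ?ler0n // expr1n.
exact: exprn_ile1.
Qed.

Section Truncation.
Variables (N : nat) (M : R).
Hypothesis M_ge : forall i, (N < i + m)%N -> (i <= N)%N -> `|a i| <= M.
Let defect := (f N)^`() + h^`() * f N.

Lemma coef_defect i : defect`_i = (f N)`_i.+1 *+ i.+1 +
  \sum_(j < m) (if (i < j)%N then 0 else (f N)`_(i - j)).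
Proof.
rewrite /defect deriv_harmonic_poly mulr_suml coefD coef_deriv coef_sum.
by congr (_ + _); apply: eq_bigr => j _; rewrite coefXnM.
Qed.

(** Below degree [N] the truncation of [f] is invisible, so the differential
    equation holds exactly. *)
Lemma coef_defect_lt i : (i < N)%N -> defect`_i = 0.
Proof.
move=> iN; rewrite coef_defect coef_poly ltnS iN -mulr_natl rough_step_rec.
apply/eqP; rewrite addrC subr_eq0; apply/eqP; apply: eq_bigr => j _.
by case: ifP => // _; rewrite coef_poly ltnS (leq_trans (leq_subr _ _)) // ltnW.
Qed.

Lemma coef_defect_le i : (N <= i)%N -> `|defect`_i| <= m%:R * M.
Proof.
move=> Ni; rewrite coef_defect coef_poly ltnS ltnNge Ni /= mul0rn add0r.
apply: (le_trans (ler_norm_sum _ _ _)).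
rewrite -[m in m%:R]card_ord mulr_natl -sumr_const; apply: ler_sum => j _.
have M0 : 0 <= M by apply: le_trans (M_ge (i := N) _ _) => //; lia.
case: ifP => ij; first by rewrite normr0.
rewrite coef_poly; case: ifP => l; last by rewrite normr0.
by apply: M_ge; have := ltn_ord j; lia.
Qed.

Lemma size_defect : (size defect <= N + m)%N.
Proof.
apply/leq_sizeP => i le_i; rewrite coef_defect coef_poly.
have -> : (i.+1 < N.+1)%N = false by lia.
rewrite mul0rn add0r big1 // => j _; case: ifP => // _.
by rewrite coef_poly; have := ltn_ord j; case: ifP => //; lia.
Qed.

Lemma horner_defect_le t : 0 <= t <= 1 -> `|defect.[t]| <= m%:R * (m%:R * M) * t ^+ N.
Proof.
move=> /andP[t0 t1]; rewrite (horner_coef_wide _ size_defect) big_split_ord /=.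
rewrite big1 ?add0r; last by move=> i _; rewrite coef_defect_lt ?mul0r.
apply: (le_trans (ler_norm_sum _ _ _)).
rewrite -[X in X%:R * (_ * _)]card_ord -mulrA mulr_natl -sumr_const.
apply: ler_sum => j _; rewrite normrM; apply: ler_pM => //.
  by apply: coef_defect_le; exact: leq_addr.
rewrite exprD normrM ger0_norm ?exprn_ge0 // ler_piMr ?exprn_ge0 //.
by rewrite ger0_norm ?exprn_ge0 // exprn_ile1.
Qed.

(** The derivative of [f e^h] is [(f' + h' f) e^h], and this product takes the
    values [1] at [0] and [p N * e^(H_m)] at [1]. *)
Lemma rough_prob_approx :
  `|p N * expR (harmonic_number R m) - 1| <=
  m%:R * (m%:R * M) * expR (harmonic_number R m) / N.+1%:R.
Proof.
pose G : R -> R := horner (f N) * (expR \o horner h).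
have GE t : G t = (f N).[t] * expR h.[t] by [].
have G1 : G 1 = p N * expR (harmonic_number R m).
  rewrite GE harmonic_poly1 -sum_rough_step horner_poly.
  by congr (_ * _); apply: eq_bigr => i _; rewrite expr1n mulr1.
have G0 : G 0 = 1.
  rewrite GE horner_coef0 coef_poly /= rough_prob0 horner_harmonic_poly.
  rewrite big1 ?expR0 ?mulr1 //.
  by move=> i _; rewrite exprS mul0r mulr0.
rewrite -G1 -[X in _ - X]G0.
apply: (dominated_increment (f := G) (df := fun t => defect.[t] * expR h.[t])).
  move=> t; have ft := is_derive_poly (f N) t; have ht := is_derive_poly h t.
  have et := is_derive_expR h.[t].
  apply: (is_derive_eq (is_deriveM ft (is_derive1_comp et ht))).
  rewrite /defect hornerD hornerM /GRing.scale /=; ring.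
move=> t t01; rewrite normrM (ger0_norm (expR_ge0 _)) mulrAC.
apply: ler_pM; rewrite ?normr_ge0 ?expR_ge0 ?horner_defect_le //.
by rewrite ler_expR harmonic_poly_le.
Qed.

End Truncation.

Lemma rough_prob_relative_error k N : ((k + 4) * m <= N)%N ->
  `|p N * expR (harmonic_number R m) - 1| <= expR 1 / k`!%:R.
Proof.
move=> le_N.
have M_ge i : (N < i + m)%N -> (i <= N)%N -> `|a i| <= ((m ^ 2 * k`!)%N%:R)^-1.
  by move=> h1 _; apply: rough_step_le; nia.
apply: (le_trans (rough_prob_approx M_ge)).
have HH : expR (harmonic_number R m) <= expR 1 * m%:R.
  by rewrite -(prednK m_gt0); exact: expR_harmonic_le.
have m0 : m%:R != 0 :> R by rewrite pnatr_eq0 -lt0n.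
have F0 : k`!%:R != 0 :> R by rewrite pnatr_eq0 -lt0n fact_gt0.
have -> : m%:R * (m%:R * (m ^ 2 * k`!)%:R^-1) = k`!%:R^-1 :> R.
  by rewrite natrM natrX; field; rewrite m0 F0.
rewrite -mulrA [leRHS]mulrC ler_wpM2l ?invr_ge0 ?ler0n //.
rewrite ler_pdivrMr ?ltr0n //; apply: (le_trans HH).
by rewrite ler_wpM2l ?expR_ge0 // ler_nat; nia.
Qed.

End RoughAnalysis.

(** * Choice of the exponent and conclusion *)

(** By [k^k / k! <= e^k] it suffices to bound [x ln x - 7 x] by [k ln k - k],
    and [ln x] exceeds [ln k] by at most [5 / k].  For
    [k >= 16] the resulting errors fit in [7 x]. *)
Lemma expR_entropy_le_fact (R : realType) k (x : R) :
  (16 <= k)%N -> k%:R <= x <= k%:R + 5 -> expR (x * ln x - 7 * x) <= k`!%:R.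
Proof.
move=> k16 /andP[kx xk].
have K16 : 16 <= k%:R :> R by rewrite (ler_nat _ 16).
have K0 : 0 < k%:R :> R by lra.
have x0 : 0 < x by lra.
have stirling : expR (k%:R * ln k%:R - k%:R) <= k`!%:R :> R.
  have F0 : 0 < k`!%:R :> R by rewrite ltr0n fact_gt0.
  have E : expR (k%:R * ln k%:R) = k%:R ^+ k :> R by rewrite expRM_natl lnK.
  have := @expR_ge1Dxn R k%:R k.-1 (ltW K0); rewrite prednK; last by lia.
  rewrite expRB E ler_pdivrMr ?expR_gt0 // => H.
  rewrite mulrC -ler_pdivrMr //; lra.
apply: le_trans stirling; rewrite ler_expR.
have l1 : ln x <= ln k%:R + (x / k%:R - 1).
  have -> : ln x = ln k%:R + ln (x / k%:R).
    by rewrite -lnM ?posrE ?divr_gt0 // mulrC divfK // gt_eqF.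
  rewrite lerD2l.
  have := @le_ln1Dx R (x / k%:R - 1); rewrite (addrC 1) subrK; apply.
  have : 0 < x / k%:R by apply: divr_gt0.
  lra.
have l2 : ln k%:R <= k%:R :> R by apply/ltW/ln_sublinear.
have l3 : 0 <= ln k%:R :> R by rewrite ln_ge0 //; lra.
have l4 : x / k%:R - 1 <= 5 / k%:R.
  rewrite lerBlDr -[X in _ + X](@divff _ (k%:R : R)) ?gt_eqF // -mulrDl.
  by rewrite ler_wpM2r ?invr_ge0 ?ler0n //; lra.
have l5 : x * (5 / k%:R) <= x.
  by rewrite ger_pMr // ler_pdivrMr //; lra.
have l6 : x * ln x <= x * (ln k%:R + 5 / k%:R) by rewrite ler_pM2l //; lra.
have l7 : x * ln k%:R <= (k%:R + 5) * ln k%:R by rewrite ler_wpM2r.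
lra.
Qed.

(** The powers of [e] met on the way are located by [2 <= e <= 4], where the
    upper bound comes from [1 - 1/2 <= e^(-1/2)]. *)
Lemma lnlnln_ge (R : realType) (x : R) : 20 < x -> -1 <= ln (ln (ln x)).
Proof.
move=> x20.
have e1 : 2 <= expR 1 :> R by have := @expR_ge1Dx R 1; lra.
have half : expR (2^-1) <= 2 :> R.
  have := @expR_ge1Dx R (- 2^-1); rewrite expRN => H.
  rewrite -[leLHS]invrK invf_ple ?posrE ?invr_gt0 ?expR_gt0 //; lra.
have e4 : expR 1 <= 4 :> R.
  have -> : 1 = 2^-1 + 2^-1 :> R by lra.
  rewrite expRD; have := @expR_ge0 R (2^-1); nra.
have l1 : 2 <= ln x.
  rewrite -(@expRK R 2) ler_ln ?posrE ?expR_gt0 //; last by lra.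
  have -> : 2 = 1 + 1 :> R by lra.
  rewrite expRD; nra.
have l2 : 2^-1 <= ln (ln x).
  by rewrite -(@expRK R (2^-1)) ler_ln ?posrE ?expR_gt0 //; lra.
rewrite -(@expRK R (-1)) ler_ln ?posrE ?expR_gt0 //; last by lra.
rewrite expRN; apply: le_trans l2; rewrite lef_pV2 ?posrE ?expR_gt0 //; lra.
Qed.

Theorem theorem1p15 (R : realType) :
  exists g : R -> R,
    [/\ forall x : R, 1 <= x <= 20 -> g x = 0,
        exists2 C : R, 0 < C &
          forall x : R, 20 < x ->
            `|g x - (x * ln x - x * ln (ln (ln x)))| <= C * x
      & exists2 C : R, 0 < C &
          forall m n : nat, (1 <= m <= n)%N ->
            exists2 e : R, `|e| <= C * expR (- g (n%:R / m%:R)) &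
              perm_prob R [set s : 'S_n | num_short_cycles m s == 0%N] =
              expR (- harmonic_number R m) * (1 + e)].
Proof.
exists (fun x => if x <= 20 then 0 else x * ln x - x * ln (ln (ln x)) - 8 * x).
split.
- by move=> x /andP[_ ->].
- exists 8 => // x x20; rewrite (lt_geF x20).
  rewrite addrAC subrr add0r normrN ger0_norm //; lra.
exists (expR 1); first exact: expR_gt0.
move=> m n /andP[m_gt0 le_mn].
have m0 : 0 < m%:R :> R by rewrite ltr0n.
exists (rough_prob R m n * expR (harmonic_number R m) - 1); last first.
  by rewrite perm_prob_rough addrC subrK mulrC -mulrA -expRD subrr expR0 mulr1.
have e2 : 2 <= expR 1 :> R by have := @expR_ge1Dx R 1; lra.
case: ifPn => [_|].
  rewrite oppr0 expR0 mulr1 ler_norml.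
  have n_gt0 : (0 < n)%N by apply: leq_trans m_gt0 le_mn.
  have := rough_prob_le R m n.-1; rewrite prednK // => /andP[p0 p1].
  have HH : expR (harmonic_number R m) <= expR 1 * m%:R.
    by rewrite -(prednK m_gt0); exact: expR_harmonic_le.
  have h0 := expR_ge0 (harmonic_number R m).
  have pH0 : 0 <= rough_prob R m n * expR (harmonic_number R m) by apply: mulr_ge0.
  have pH1 : rough_prob R m n * expR (harmonic_number R m) <= expR 1.
    apply: (le_trans (ler_pM p0 h0 p1 HH)); rewrite mulrCA ger_pMr ?expR_gt0 //.
    by rewrite ler_pdivrMl ?ltr0n // mulr1 ler_nat.
  by apply/andP; split; lra.
rewrite -ltNge => x20; set x := _ / _ in x20 *.
(* The decay of the increments starts only after three blocks of [m] indices,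
   and one more is needed for the window of increments below [n]. *)
pose k := (n %/ m - 4)%N.
have q20 : (20 <= n %/ m)%N.
  by rewrite leq_divRL //; move: x20; rewrite /x ltr_pdivlMr // -natrM ltr_nat => /ltnW.
have kdef : (k + 4 = n %/ m)%N by rewrite /k; lia.
have le_kn : ((k + 4) * m <= n)%N by rewrite kdef leq_trunc_div.
apply: (le_trans (rough_prob_relative_error R m_gt0 le_kn)).
rewrite ler_pM2l ?expR_gt0 // expRN lef_pV2 ?posrE ?expR_gt0 ?ltr0n ?fact_gt0 //.
have kx : k%:R <= x <= k%:R + 5.
  rewrite /x ler_pdivlMr // ler_pdivrMr // -!natrM -natrD -natrM !ler_nat.
  apply/andP; split; first by nia.
  have := ltn_ceil n m_gt0; rewrite -kdef; nia.
apply: le_trans (expR_entropy_le_fact _ kx); last by lia.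
rewrite ler_expR; have := lnlnln_ge x20 => L.
have : - x <= x * ln (ln (ln x)) by nra.
lra.
Qed.
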